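(* Let $D$ be a Prüfer domain that is the union of a directed integral system of Dedekind domains. Then all the overrings of $D$ are atomic if and only if $D$ is a Dedekind domain.
   Context: For an integral domain $R$, $\mathrm{qf}(R)$ denotes its quotient field. An overring of $R$ is a ring $S$ with $R \subseteq S \subseteq \mathrm{qf}(R)$. An integral domain is atomic if every nonzero nonunit element factors into (finitely many) irreducible elements. A Prüfer domain is an integral domain in which every nonzero finitely generated ideal is invertible. Fields are counted as Dedekind domains (and Prüfer domains). A directed set is a partially ordered set $\Lambda$ such that for all $\alpha,\beta\in\Lambda$ there is $\theta\in\Lambda$ with $\alpha\le\theta$ and $\beta\le\theta$. A family of integral domains $\{R_\lambda\}_{\lambda\in\Lambda}$ is a directed system of integral domains if $\Lambda$ is a directed set and $R_\alpha\subseteq R_\beta$ (as a subring) whenever $\alpha\le\beta$; its union is $\bigcup_{\lambda\in\Lambda}R_\lambda$. It is a directed integral system if, moreover, for all $\alpha\le\beta$ in $\Lambda$ the ring extension $R_\alpha\subseteq R_\beta$ is integral and $[\mathrm{qf}(R_\beta):\mathrm{qf}(R_\alpha)]<\infty$. A directed integral system of Dedekind domains is one in which every $R_\lambda$ is a Dedekind domain. *)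

(* Defs.v *)
From HB Require Import structures.
From mathcomp Require Import all_boot all_order all_algebra.
From mathcomp Require Import boolp classical_sets.

Set Implicit Arguments.
Unset Strict Implicit.
Unset Printing Implicit Defensive.

Import Order.TTheory GRing.Theory Num.Theory.
Local Open Scope classical_set_scope.
Local Open Scope ring_scope.

(* Integral domains are represented as subrings [R : set K] of an arbitrary
   ambient field K: every integral domain arises this way (e.g. with K its
   fraction field), and inclusions between domains are then literal set
   inclusions. *)
Section Domains.
Context {K : fieldType}.
Implicit Types R S D I J P M : set K.

Definition is_subring R : Prop := subring_closed (mem R).

Definition qf R : set K :=
  [set x | exists a b, [/\ R a, R b, b != 0 & x = a / b]].

Definition is_unit R (x : K) : Prop := [/\ R x, x != 0 & R x^-1].

Definition is_irreducible R (x : K) : Prop :=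
  [/\ R x, x != 0, ~ is_unit R x &
      forall a b, R a -> R b -> x = a * b -> is_unit R a \/ is_unit R b].

Definition is_atomic R : Prop :=
  forall x, R x -> x != 0 -> ~ is_unit R x ->
  exists2 s : seq K, (forall a, a \in s -> is_irreducible R a)
                   & x = \prod_(a <- s) a.

Definition is_overring D S : Prop :=
  [/\ is_subring S, D `<=` S & S `<=` qf D].

Definition is_submodule R J : Prop :=
  [/\ J 0, (forall x y, J x -> J y -> J (x + y))
    & (forall r x, R r -> J x -> J (r * x))].

Definition is_ideal R I : Prop := is_submodule R I /\ I `<=` R.

Definition span R n (e : 'I_n -> K) : set K :=
  [set x | exists2 c : 'I_n -> K, (forall i, R (c i))
                                & x = \sum_(i < n) c i * e i].

Definition is_fg R J : Prop := exists n (e : 'I_n -> K), J = span R e.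

Definition is_nonzero J : Prop := exists2 x, J x & x != 0.

Definition is_fractional R J : Prop :=
  [/\ is_submodule R J, J `<=` qf R &
      exists d, [/\ R d, d != 0 & forall x, J x -> R (d * x)]].

Definition prod_module I J : set K :=
  [set x | exists n (a b : 'I_n -> K),
     [/\ forall i, I (a i), forall i, J (b i) & x = \sum_(i < n) a i * b i]].

Definition is_invertible R I : Prop :=
  exists2 J, is_fractional R J & prod_module I J = R.

Definition is_prime_ideal R P : Prop :=
  [/\ is_ideal R P, P <> R &
      forall x y, R x -> R y -> P (x * y) -> P x \/ P y].

Definition is_maximal_ideal R M : Prop :=
  [/\ is_ideal R M, M <> R &
      forall I, is_ideal R I -> M `<=` I -> I = M \/ I = R].

Definition is_integral_over R (x : K) : Prop :=
  exists p : {poly K}, [/\ p \is monic, p \is a polyOver (mem R) & root p x].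

Definition is_integrally_closed R : Prop :=
  forall x, qf R x -> is_integral_over R x -> R x.

Definition is_noetherian R : Prop := forall I, is_ideal R I -> is_fg R I.

Definition is_prufer R : Prop :=
  is_subring R /\
  forall I, is_ideal R I -> is_nonzero I -> is_fg R I -> is_invertible R I.

(* Dimension at most one, so that fields are included. *)
Definition is_dedekind R : Prop :=
  [/\ is_subring R, is_noetherian R, is_integrally_closed R &
      forall P, is_prime_ideal R P -> is_nonzero P -> is_maximal_ideal R P].

Definition is_integral_extension R S : Prop :=
  R `<=` S /\ forall x, S x -> is_integral_over R x.

(* [E : F] < oo, for subfields F `<=` E of K. *)
Definition finite_degree (F E : set K) : Prop :=
  exists n (e : 'I_n -> K), (forall i, E (e i)) /\ E `<=` span F e.

Definition is_directed (disp : Order.disp_t) (L : porderType disp) : Prop :=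
  forall a b : L, exists t : L, (a <= t)%O && (b <= t)%O.

Definition is_directed_system (disp : Order.disp_t) (L : porderType disp)
    (R : L -> set K) : Prop :=
  [/\ is_directed L, (forall a, is_subring (R a)) &
      forall a b, (a <= b)%O -> R a `<=` R b].

Definition is_directed_integral_system (disp : Order.disp_t)
    (L : porderType disp) (R : L -> set K) : Prop :=
  is_directed_system R /\
  forall a b, (a <= b)%O ->
    is_integral_extension (R a) (R b) /\ finite_degree (qf (R a)) (qf (R b)).

End Domains.

(* Main.v *)
From mathcomp Require Import all_boot all_order all_algebra ring.
From mathcomp Require Import boolp classical_sets.
Require Import Defs.

(** The content of the theorem is that [D] is Noetherian when all its overrings
    are atomic. Fix a nonzero [x] in [D] and localize [D] at the multiplicative
    set [1 + x * D], so that [x] enters the Jacobson radical.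

    In a Dedekind domain only finitely many primes contain [x], and by the
    Chinese remainder theorem every nonzero ideal has an element [c] that
    generates it locally at these primes; inverting [1 + x * R] makes the ideal
    principal ([dedekind_generator_mod]). For an ideal generated by two elements
    this is a statement about finitely many elements of the domain, so it is
    inherited by the directed union [D]: the localization of [D] is a Bezout
    domain. Being an overring of [D] it is also atomic, and an atomic Bezout
    domain is a principal ideal domain ([bezout_atomic_principal]).

    Since [D] and its localization have the same quotient modulo [x], this
    descends: an ideal [I] of [D] containing [x] is generated by [x] and one
    further element ([atomic_overrings_noetherian]), and the nonzero primes of
    [D] are maximal because they are so in the localization
    ([atomic_overrings_primes_maximal]). Integral closedness passes to directed
    unions because an integral equation has finitely many coefficients.

    Conversely, if [D] is Noetherian, then invertibility of two-generated ideals
    shows that every ideal of an overring is generated by its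
    intersection with [D] ([prufer_noetherian_overring]); overrings are thus
    Noetherian, and Noetherian domains are atomic. *)

Local Open Scope classical_set_scope.
Local Open Scope ring_scope.
Import GRing.Theory.

Set Implicit Arguments.
Unset Strict Implicit.
Unset Printing Implicit Defensive.

(** * Subrings, ideals and generators *)

Section Domains.
Context {K : fieldType}.
Implicit Types (R S A D I J M P : set K).

Section Closure.
Variables (R : set K) (hR : is_subring R).

Lemma subring1 : R 1.
Proof. by case: hR => h _ _; move: h; rewrite -topredE /= => /set_mem. Qed.

Lemma subringB x y : R x -> R y -> R (x - y).
Proof. by case: hR => _ h _ /mem_set hx /mem_set hy; apply/set_mem/h. Qed.

Lemma subringM x y : R x -> R y -> R (x * y).
Proof. by case: hR => _ _ h /mem_set hx /mem_set hy; apply/set_mem/h. Qed.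

Lemma subring0 : R 0.
Proof. by rewrite -(subrr 1); apply: subringB; exact: subring1. Qed.

Lemma subringN x : R x -> R (- x).
Proof. by move=> hx; rewrite -sub0r; apply: subringB => //; exact: subring0. Qed.

Lemma subringD x y : R x -> R y -> R (x + y).
Proof. by move=> hx hy; rewrite -[y]opprK; apply/subringB/subringN. Qed.

End Closure.

Lemma subringI R : R 1 -> (forall x y, R x -> R y -> R (x - y)) ->
  (forall x y, R x -> R y -> R (x * y)) -> is_subring R.
Proof.
move=> h1 hB hM; split; first exact/mem_set.
- by move=> x y /set_mem hx /set_mem hy; apply/mem_set/hB.
- by move=> x y /set_mem hx /set_mem hy; apply/mem_set/hM.
Qed.


Lemma subring_prod R (s : seq K) :
  is_subring R -> (forall a, a \in s -> R a) -> R (\prod_(a <- s) a).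
Proof.
move=> hR hs; rewrite big_seq; apply: big_ind => //; first exact: subring1.
by move=> x y; exact: subringM.
Qed.

Lemma ideal_sub R I : is_ideal R I -> I `<=` R. Proof. by case. Qed.

Lemma ideal0 R I : is_ideal R I -> I 0. Proof. by case=> -[]. Qed.

Lemma idealD R I x y : is_ideal R I -> I x -> I y -> I (x + y).
Proof. by case=> -[] _ h _ _; exact: h. Qed.

Lemma idealM R I r x : is_ideal R I -> R r -> I x -> I (r * x).
Proof. by case=> -[] _ _ h _; exact: h. Qed.

Lemma idealMr R I r x : is_ideal R I -> I x -> R r -> I (x * r).
Proof. by move=> hI hx hr; rewrite mulrC; exact: (idealM hI). Qed.

Lemma ideal_mem1 R I : is_ideal R I -> I 1 -> I = R.
Proof.
move=> hI h1; apply/seteqP; split; first exact: ideal_sub hI.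
by move=> x hx; rewrite -[x]mulr1; exact: (idealM hI).
Qed.

Lemma span_gen R n (e : 'I_n -> K) i : is_subring R -> span R e (e i).
Proof.
move=> hR; exists (fun j => (j == i)%:R).
  by move=> j; case: (j == i); [exact: subring1|exact: subring0].
rewrite (bigD1 i) //= eqxx mul1r big1 ?addr0 // => j /negPf ->.
by rewrite mul0r.
Qed.

Lemma span_sub R J n (e : 'I_n -> K) :
  is_submodule R J -> (forall i, J (e i)) -> span R e `<=` J.
Proof.
move=> [h0 hD hM] he _ [c hc ->].
by apply: big_ind => // i _; exact: hM.
Qed.

Definition multiples R x : set K := [set y | exists2 r, R r & y = x * r].

Definition adjoin R I x : set K :=
  [set y | exists i r, [/\ I i, R r & y = i + x * r]].

Lemma adjoin_ideal R I x :
  is_subring R -> is_ideal R I -> R x -> is_ideal R (adjoin R I x).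
Proof.
move=> hR hI hx; split; first split.
- by exists 0, 0; rewrite mulr0 addr0; split; [exact: ideal0 hI|exact: subring0|].
- move=> _ _ [i [r [hi hr ->]]] [j [s [hj hs ->]]]; exists (i + j), (r + s).
  by split; [exact: (idealD hI)|exact: subringD|ring].
- move=> t _ ht [i [r [hi hr ->]]]; exists (t * i), (t * r).
  by split; [exact: (idealM hI)|exact: subringM|ring].
- move=> _ [i [r [hi hr ->]]]; apply: subringD => //; first exact: (ideal_sub hI).
  exact: subringM.
Qed.

Lemma sub_adjoin R I x : is_subring R -> I `<=` adjoin R I x.
Proof.
move=> hR i hi; exists i, 0; rewrite mulr0 addr0.
by split => //; exact: subring0.
Qed.

Lemma mem_adjoin R I x : is_subring R -> is_ideal R I -> adjoin R I x x.
Proof.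
move=> hR hI; exists 0, 1; rewrite mulr1 add0r.
by split; [exact: (ideal0 hI)|exact: subring1|].
Qed.

(** * Noetherian domains *)

(** This is how finitely many data are moved into a single member of a directed
    union; it serves both for ascending chains of ideals and for the directed
    system of the theorem. *)
Lemma finite_family_directed (T : Type) (F : T -> set K) (t0 : T) :
  (forall a b, exists c, F a `<=` F c /\ F b `<=` F c) ->
  forall n (e : 'I_n -> K), (forall i, exists t, F t (e i)) ->
  exists t, forall i, F t (e i).
Proof.
move=> hdir; elim=> [|n ih] e he; first by exists t0 => -[].
have [t ht] := ih (fun i => e (lift ord0 i)) (fun i => he _).
have [s hs] := he ord0; have [c [htc hsc]] := hdir t s.
exists c => i; case: (unliftP ord0 i) => [j ->|->]; first exact/htc/ht.
exact: hsc.
Qed.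

(** Noetherian induction: a counterexample would start a strictly ascending
    chain of ideals, and a finite generating family of the union of the chain
    lies in one of its terms. *)
Lemma noetherian_ind R (Q : set K -> Prop) : is_subring R -> is_noetherian R ->
  (forall I, is_ideal R I ->
     (forall J, is_ideal R J -> I `<=` J -> ~ J `<=` I -> Q J) -> Q I) ->
  forall I, is_ideal R I -> Q I.
Proof.
move=> hR hN hstep I0 hI0; apply: contrapT => hbad0.
have grow (I : set K) : exists J, is_ideal R I /\ ~ Q I ->
    [/\ is_ideal R J, ~ Q J, I `<=` J & ~ J `<=` I].
  have [[hI hb]|] := pselect (is_ideal R I /\ ~ Q I); last by exists I.
  apply: contrapT => hno; apply: hb; apply: hstep => // J hJ hIJ hJI.
  by apply: contrapT => hbJ; apply: hno; exists J.
have [f hf] := choice grow.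
pose F n := iter n f I0.
have hF n : is_ideal R (F n) /\ ~ Q (F n).
  by elim: n => [|n ih] //=; case: (hf _ ih).
have hFmono m n : (m <= n)%N -> F m `<=` F n.
  elim: n => [|n ih]; first by rewrite leqn0 => /eqP ->.
  rewrite leq_eqVlt => /predU1P[-> //|/ih h]; apply: subset_trans h _.
  by case: (hf _ (hF n)).
have hdir a b : exists c, F a `<=` F c /\ F b `<=` F c.
  by exists (maxn a b); split; apply: hFmono; rewrite ?leq_maxl ?leq_maxr.
pose U := [set x | exists n, F n x].
have hU : is_ideal R U.
  split; first split.
  - by exists 0%N; exact: (ideal0 hI0).
  - move=> x y [m hx] [n hy]; have [c [hm hn]] := hdir m n; exists c.
    by apply: (idealD (hF c).1); [exact: hm|exact: hn].
  - by move=> r x hr [n hx]; exists n; exact: (idealM (hF n).1).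
  - by move=> x [n]; exact: (ideal_sub (hF n).1).
have [m [e eU]] := hN _ hU.
have he i : exists t, F t (e i).
  have : U (e i); last by [].
  by rewrite eU; exact: span_gen.
have [N hNe] := finite_family_directed 0%N hdir he.
have [_ _ _] := hf _ (hF N); apply => x hx.
apply: (span_sub (hF N).1.1 hNe); rewrite -eU.
by exists N.+1.
Qed.

Lemma multiples_ideal R x :
  is_subring R -> R x -> is_ideal R (multiples R x).
Proof.
move=> hR hx; split; first split.
- by exists 0; rewrite ?mulr0 //; exact: subring0.
- move=> _ _ [r hr ->] [s hs ->]; exists (r + s); last by rewrite mulrDr.
  exact: subringD.
- by move=> t _ ht [r hr ->]; exists (t * r); [exact: subringM|rewrite mulrCA].
- by move=> _ [r hr ->]; exact: subringM.
Qed.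

Lemma noetherian_max R (F : set K -> Prop) I0 :
  is_subring R -> is_noetherian R -> (forall I, F I -> is_ideal R I) -> F I0 ->
  exists2 I, F I & forall J, F J -> I `<=` J -> J `<=` I.
Proof.
move=> hR hN hF hI0; apply: contrapT => hno.
have hnF I : is_ideal R I -> ~ F I.
  move: I; apply: (noetherian_ind hR hN) => I hI ih hFI; apply: hno.
  exists I => // J hJ hIJ; apply: contrapT => hJI.
  exact: (ih J (hF _ hJ) hIJ hJI).
exact: (hnF I0 (hF _ hI0)).
Qed.

(** The generators of the union of the chain of ideals [d * R[z]_(deg < n)] have
    bounded degree in [z], so that a power [d * z ^+ N] of larger degree is a
    combination of smaller ones; cancelling [d] yields an integral equation. *)
Lemma noetherian_almost_integral R z d :
  is_subring R -> is_noetherian R -> d != 0 -> (forall k, R (d * z ^+ k)) ->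
  is_integral_over R z.
Proof.
move=> hR hN d0 hdz.
pose I := [set y | exists p : {poly K}, (forall k, R p`_k) /\ y = d * p.[z]].
have hI : is_ideal R I.
  split; first split.
  - exists 0; rewrite horner0 mulr0; split => // k; rewrite coef0.
    exact: subring0.
  - move=> _ _ [p [hp ->]] [q [hq ->]]; exists (p + q); split => [k|].
      by rewrite coefD; exact: subringD.
    by rewrite hornerD mulrDr.
  - move=> r _ hr [p [hp ->]]; exists (r *: p); split => [k|].
      by rewrite coefZ; exact: subringM.
    by rewrite hornerZ mulrCA.
  - move=> _ [p [hp ->]]; rewrite horner_coef mulr_sumr.
    apply: big_ind => [|x y|i _]; first exact: subring0.
      exact: subringD.
    by rewrite mulrCA; exact: subringM.
have [m [e eI]] := hN _ hI.
have /choice[q hq] i : exists p : {poly K}, (forall k, R p`_k) /\ e i = d * p.[z].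
  suff : I (e i) by [].
  by rewrite eI; exact: span_gen.
pose N := \max_i size (q i).
have : I (d * z ^+ N).
  exists 'X^N; rewrite hornerXn; split => // k; rewrite coefXn.
  by case: (k == N); [exact: subring1|exact: subring0].
rewrite eI => -[c hc hzN].
pose s := \sum_i c i *: q i.
have hs : (size s <= N)%N.
  apply: leq_trans (size_sum _ _ _) _; apply/bigmax_leqP => i _.
  apply: leq_trans (size_scale_leq _ _) _.
  exact: (leq_bigmax (F := fun i => size (q i))).
exists ('X^N - s); split.
- by rewrite monicE lead_coefDl ?lead_coefXn // size_polyN size_polyXn ltnS.
- apply/(all_nthP 0) => k _; apply/mem_set; rewrite coefB coefXn.
  apply: (subringB hR).
    by case: (k == N); [exact: subring1|exact: subring0].
  rewrite coef_sum; apply: big_ind => [|x y|i _]; first exact: subring0.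
    exact: subringD.
  by rewrite coefZ; apply: subringM => //; case: (hq i).
- rewrite rootE hornerD hornerN hornerXn subr_eq0; apply/eqP.
  apply: (mulfI d0); rewrite hzN horner_sum mulr_sumr; apply: eq_bigr => i _.
  by have [_ ->] := hq i; rewrite hornerZ mulrCA.
Qed.

(** Of two factors of a reducible element each generates a strictly larger
    principal ideal, so Noetherian induction produces a factorization. *)
Lemma noetherian_atomic R : is_subring R -> is_noetherian R -> is_atomic R.
Proof.
move=> hR hN.
have hmul x : R x -> is_ideal R (multiples R x) by exact: multiples_ideal.
suff main I : is_ideal R I -> forall x, I = multiples R x -> R x -> x != 0 ->
    ~ is_unit R x -> exists2 s : seq K, (forall a, a \in s -> is_irreducible R a)
                                      & x = \prod_(a <- s) a.
  by move=> x hx; exact: (main _ (hmul x hx) x).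
move: I; apply: (noetherian_ind hR hN) => I _ ih x eI hx x0 hxu.
have [hirr|hred] := pselect (is_irreducible R x).
  by exists [:: x]; rewrite ?big_seq1 // => a; rewrite inE => /eqP ->.
have [a [b [ha hb eab hau hbu]]] : exists a b,
    [/\ R a, R b, x = a * b, ~ is_unit R a & ~ is_unit R b].
  apply: contrapT => hno; apply: hred; split => // a b ha hb eab.
  apply: contrapT => /not_orP[hau hbu]; apply: hno; exists a, b.
  by [].
have step u v : R u -> R v -> x = u * v -> ~ is_unit R v ->
    [/\ u != 0, multiples R x `<=` multiples R u &
        ~ multiples R u `<=` multiples R x].
  move=> hu hv euv hvu; move: x0; rewrite euv mulf_eq0 negb_or => /andP[u0 v0].
  split => // [_ [r hr ->]|].
    by exists (v * r); [exact: subringM|rewrite mulrA].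
  move=> /(_ u)[|r hr eu]; first by exists 1; rewrite ?mulr1 //; exact: subring1.
  apply: hvu; split => //; suff <- : r = v^-1 by [].
  by apply: (mulfI v0); rewrite mulfV //; apply: (mulfI u0); rewrite mulrA -eu mulr1.
have [a0 ha1 ha2] := step _ _ ha hb eab hbu.
have [b0 hb1 hb2] := step _ _ hb ha (etrans eab (mulrC a b)) hau.
rewrite eI in ih.
have [s hs es] := ih _ (hmul a ha) ha1 ha2 a erefl ha a0 hau.
have [t ht et] := ih _ (hmul b hb) hb1 hb2 b erefl hb b0 hbu.
exists (s ++ t); last by rewrite big_cat eab es et.
by move=> c; rewrite mem_cat => /orP[/hs|/ht].
Qed.

(** * Overrings of Noetherian Pruefer domains *)

(** Clearing [a, b] with the inverse of the ideal they generate: [u] and [v]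
    lie in that inverse. *)
Lemma prufer_pair D a b : is_prufer D -> D a -> D b -> b != 0 ->
  exists u v, [/\ D (u * a), D (u * b), D (v * a), D (v * b) &
                  u * a + v * b = 1].
Proof.
move=> [hD hinv] ha hb b0.
pose e (i : 'I_2) := if i == ord0 then a else b.
have he i : span D e (e i) by exact: span_gen.
have hIe : is_ideal D (span D e).
  split; last first.
    apply: span_sub; last by move=> i; rewrite /e; case: ifP.
    split; [exact: subring0|move=> x y; exact: subringD|move=> x y; exact: subringM].
  split.
  - exists (fun=> 0) => [i|]; first exact: subring0.
    by rewrite big1 // => i _; rewrite mul0r.
  - move=> _ _ [c hc ->] [d hd ->]; exists (fun i => c i + d i) => [i|].
      exact: subringD.
    by rewrite -big_split; apply: eq_bigr => i _; rewrite mulrDl.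
  - move=> r _ hr [c hc ->]; exists (fun i => r * c i) => [i|].
      exact: subringM.
    by rewrite mulr_sumr; apply: eq_bigr => i _; rewrite mulrA.
have [] := hinv _ hIe.
- by exists b => //; exact: (he ord_max).
- by exists 2%N, e.
move=> J [[J0 JD JM] _ _] hIJ.
have hJ w x : J w -> span D e x -> D (w * x).
  move=> hw hx; rewrite -hIJ; exists 1%N, (fun=> x), (fun=> w).
  by rewrite big_ord1 mulrC; split.
have [n [x [y [hx hy e1]]]] : prod_module (span D e) J 1.
  by rewrite hIJ; exact: subring1.
have /choice[c hc] i : exists c : 'I_2 -> K,
    (forall j, D (c j)) /\ x i = \sum_(j < 2) c j * e j.
  by have [c hc ->] := hx i; exists c.
pose w j := \sum_(i < n) c i j * y i.
have hw j : J (w j).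
  by apply: big_ind => // i _; apply: JM => //; case: (hc i).
exists (w ord0), (w ord_max).
have hwa j : D (w j * a) by apply: hJ; [exact: hw|exact: (he ord0)].
have hwb j : D (w j * b) by apply: hJ; [exact: hw|exact: (he ord_max)].
split => //.
rewrite e1 !mulr_suml -big_split; apply: eq_bigr => i _ /=.
rewrite (hc i).2 big_ord_recl big_ord1 /e /=.
have -> : lift ord0 ord0 = ord_max :> 'I_2 by exact: val_inj.
by ring.
Qed.

(** A fraction [x = a / b] in an ideal [I] of the overring [S] is a combination
    [x * (u * a) + v * a] with [u * a = x * (u * b)] and [v * a = x * (v * b)] in
    [I `&` D], for [u, v] as in [prufer_pair]. Hence the generators of the
    ideal [I `&` D] of [D] generate [I]. *)
Lemma prufer_noetherian_overring D S :
  is_prufer D -> is_noetherian D -> is_overring D S -> is_noetherian S.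
Proof.
move=> hDP hN [hS hDS hSq] I hI; have hD := hDP.1.
have hID : is_ideal D (I `&` D).
  split; first split.
  - by split; [exact: (ideal0 hI)|exact: subring0].
  - by move=> x y [hx Dx] [hy Dy]; split; [exact: (idealD hI)|exact: subringD].
  - move=> r x hr [hx Dx]; split; last exact: subringM.
    by apply: (idealM hI) => //; exact: hDS.
  - by move=> x [].
have [n [e eI]] := hN _ hID.
have he i : (I `&` D) (e i) by rewrite eI; exact: span_gen.
have hspan r x : S r -> (I `&` D) x -> span S e (r * x).
  move=> hr; rewrite eI => -[c hc ->]; exists (fun i => r * c i) => [i|].
    by apply: subringM => //; exact: hDS.
  by rewrite mulr_sumr; apply: eq_bigr => i _; rewrite mulrA.
exists n, e; apply/seteqP; split; last first.
  by apply: span_sub; [case: hI|move=> i; case: (he i)].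
move=> x hx; have hxS := ideal_sub hI hx.
have [a [b [ha hb b0 ex]]] := hSq x hxS.
have [u [v [hua hub hva hvb euv]]] := prufer_pair hDP ha hb b0.
have hmem w : D (w * a) -> D (w * b) -> (I `&` D) (w * a).
  move=> hwa hwb; split => //; have -> : w * a = w * b * x by rewrite ex; field.
  by apply: (idealM hI) => //; exact: hDS.
have -> : x = x * (u * a) + 1 * (v * a).
  by rewrite mul1r -[LHS]mulr1 -euv mulrDr; congr (_ + _); rewrite ex; field.
have [c hc ->] := hspan _ _ hxS (hmem _ hua hub).
have [d hd ->] := hspan _ _ (subring1 hS) (hmem _ hva hvb).
exists (fun i => c i + d i) => [i|]; first exact: subringD.
by rewrite -big_split; apply: eq_bigr => i _; rewrite mulrDl.
Qed.

(** * Ideals of a Dedekind domain modulo a nonzero element *)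

Lemma prime_idealW R P : is_prime_ideal R P -> is_ideal R P.
Proof. by case. Qed.

Definition colon R I : set K := [set u | forall i, I i -> R (u * i)].

(** Among the ideals [(aR : b)] contained in [P] take a maximal one. It is
    prime: if [r * s] lies in it and [s] does not, then [(aR : r * b)] is larger,
    hence contains some [t] outside [P]; then [(aR : t * b)] is still inside [P],
    so it equals [(aR : b)], and it contains [r]. Dimension one identifies this
    prime with [P]. *)
Lemma prime_is_colon R P a :
  is_subring R -> is_noetherian R ->
  (forall Q, is_prime_ideal R Q -> is_nonzero Q -> is_maximal_ideal R Q) ->
  is_prime_ideal R P -> P a -> a != 0 ->
  exists b, [/\ R b, ~ multiples R a b & forall p, P p -> multiples R a (p * b)].
Proof.
move=> hR hN hdim [hP PR Pprime] hPa a0; have Ra := ideal_sub hP hPa.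
have notP1 : ~ P 1 by move=> h; exact/PR/(ideal_mem1 hP h).
pose col b := [set r | R r /\ multiples R a (r * b)].
have hcol b : R b -> is_ideal R (col b).
  move=> hb; have [[h0 hD hM] _] := multiples_ideal hR Ra.
  split; first split.
  - by split; [exact: subring0|rewrite mul0r].
  - move=> r s [hr hrb] [hs hsb]; split; first exact: subringD.
    by rewrite mulrDl; exact: hD.
  - move=> r s hr [hs hsb]; split; first exact: subringM.
    by rewrite -mulrA; exact: hM.
  - by move=> r [].
pose F I := exists2 b, R b & I = col b /\ col b `<=` P.
 have [I [b hb [-> hbP]] hmax] :
    exists2 I, F I & forall J, F J -> I `<=` J -> J `<=` I.
  apply: (noetherian_max (I0 := col 1) hR hN) => [I [b hb [-> _]]|].
    exact: hcol.
  exists 1; first exact: subring1.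
  by split => // r [_]; rewrite mulr1 => -[s hs ->]; exact: (idealMr hP).
have {}hmax c : R c -> col c `<=` P -> col b `<=` col c -> col c `<=` col b.
  by move=> hc hcP; apply: hmax; exists c.
have colM c t : R t -> R c -> col c `<=` col (t * c).
  move=> ht hc r [hr [s hs es]]; split => //; exists (t * s).
    exact: subringM.
  by rewrite mulrCA es mulrCA.
have hprime : is_prime_ideal R (col b).
  split; first exact: hcol.
    by move=> eR; apply/notP1/hbP; rewrite eR; exact: subring1.
  move=> r s hr hs [_ hrsb]; apply: contrapT => /not_orP[hrb hsb].
  have Rrb : R (r * b) by exact: subringM.
  have [t [ht hPt]] : exists t, col (r * b) t /\ ~ P t.
    apply: contrapT => /forallNP hno; apply: hsb.
    apply: (hmax (r * b)) => //; last 1 first.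
    - by split => //; rewrite mulrA [s * r]mulrC.
    - by move=> q hq; apply: contrapT => hPq; apply: (hno q).
    - exact: colM.
  have [Rt htrb] := ht.
  apply: hrb; apply: (hmax (t * b)); first exact: subringM; last 1 first.
  - by split => //; rewrite mulrCA.
  - move=> q [hq hqtb].
    have : P (q * t) by apply: hbP; split; [exact: subringM|rewrite -mulrA].
    by case/Pprime.
  - exact: colM.
have [_ _] : is_maximal_ideal R (col b).
  by apply: hdim => //; exists a => //; split => //; exists b.
move=> /(_ P hP hbP) [eP|//].
exists b; split => //.
  by move=> hab; apply: notP1; rewrite eP; split; [exact: subring1|rewrite mul1r].
by move=> p; rewrite eP => -[].
Qed.

(** If [I * (R : I)] were inside [P], then [z = b / a] with [P = (aR : b)] would
    send [(R : I)] into itself, so that [z] would be almost integral over [R]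
    and hence lie in [R], against [b] not being a multiple of [a]. *)
Lemma dedekind_invertible_at_prime R I P :
  is_dedekind R -> is_ideal R I -> is_nonzero I ->
  is_prime_ideal R P -> is_nonzero P ->
  exists i u, [/\ I i, colon R I u & ~ P (i * u)].
Proof.
move=> [hR hN hIC hdim] hI [i0 hi0 i00] hP [a hPa a0].
apply: contrapT => hno.
have {hno} hIP i u : I i -> colon R I u -> P (i * u).
  by move=> hi hu; apply: contrapT => h; apply: hno; exists i, u.
have [b [hb hnb hPb]] := prime_is_colon hR hN hdim hP hPa a0.
pose z := b / a.
have hz p : P p -> R (z * p).
  move=> /hPb[r hr er]; have -> : z * p = r; last by [].
  by apply: (mulfI a0); rewrite -er /z; field.
have hcol k : colon R I (z ^+ k).
  elim: k => [|k ih] i hi; first by rewrite mul1r; exact: (ideal_sub hI).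
  by rewrite exprS -mulrA [_ ^+ _ * _]mulrC; exact/hz/hIP.
apply: hnb; exists z; last by rewrite /z; field.
apply: hIC; first by exists b, a; split => //; exact: (ideal_sub (prime_idealW hP)).
apply: (noetherian_almost_integral hR hN i00) => k.
by rewrite mulrC; exact: hcol.
Qed.

Lemma nonzero_primes_incomparable R P Q :
  is_dedekind R -> is_prime_ideal R P -> is_nonzero P -> is_prime_ideal R Q ->
  P <> Q -> exists2 p, P p & ~ Q p.
Proof.
move=> [_ _ _ hdim] hP P0 [hQ QR _] hPQ; apply: contrapT => hno.
have [_ _] := hdim P hP P0.
move=> /(_ Q hQ)[p hp|eQ|//]; last exact/hPQ.
by apply: contrapT => hq; apply: hno; exists p.
Qed.

(** Noetherian induction: if [r * s] is in [I] but [r] and [s] are not, then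
    every proper ideal above [I] stays proper after adjoining one of them, since
    the product of the two enlarged ideals is contained in the original. *)
Lemma dedekind_finitely_many_primes R I :
  is_dedekind R -> is_ideal R I -> is_nonzero I ->
  exists Ps : seq (set K),
    (forall P, P \in Ps -> is_prime_ideal R P /\ is_nonzero P) /\
    (forall J, is_ideal R J -> I `<=` J -> J <> R ->
       exists2 P, P \in Ps & J `<=` P).
Proof.
move=> [hR hN _ hdim]; move: I.
apply: (noetherian_ind hR hN) => I hI ih I0.
have [eI|IR] := pselect (I = R).
  exists [::]; split => // J hJ hIJ JR; exfalso; apply: JR.
  by apply/seteqP; split; [case: hJ|rewrite -[X in X `<=` _]eI].
have [hprime|hnprime] := pselect (is_prime_ideal R I).
  exists [:: I]; split => [P|J hJ hIJ JR]; first by rewrite inE => /eqP ->.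
  exists I; first by rewrite inE.
  by have [_ _ /(_ J hJ hIJ) [->|/JR]] := hdim I hprime I0.
have [r [s [hr hs hrs hIr hIs]]] : exists r s,
    [/\ R r, R s, I (r * s), ~ I r & ~ I s].
  apply: contrapT => hno; apply: hnprime; split => // r s hr hs hrs.
  apply: contrapT => /not_orP[hIr hIs]; apply: hno; exists r, s.
  by [].
have sub t : I `<=` adjoin R I t by exact: sub_adjoin.
have primes_adjoin t : R t -> ~ I t -> exists Ps : seq (set K),
    (forall P, P \in Ps -> is_prime_ideal R P /\ is_nonzero P) /\
    (forall J, is_ideal R J -> adjoin R I t `<=` J -> J <> R ->
       exists2 P, P \in Ps & J `<=` P).
  move=> ht hIt; apply: ih; [exact: adjoin_ideal|exact: sub| |].
    by move=> h; exact/hIt/h/mem_adjoin.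
  by have [i hi i0] := I0; exists i => //; exact: sub.
have [Ps [hPs hPsJ]] := primes_adjoin r hr hIr.
have [Qs [hQs hQsJ]] := primes_adjoin s hs hIs.
exists (Ps ++ Qs); split => [P|J hJ hIJ JR].
  by rewrite mem_cat => /orP[/hPs|/hQs].
have hmono t : adjoin R I t `<=` adjoin R J t.
  by move=> _ [i [w [hi hw ->]]]; exists i, w; split => //; exact: hIJ.
have [hJr|hJr] := pselect (adjoin R J r = R); last first.
  have [P hP hJP] := hPsJ _ (adjoin_ideal hR hJ hr) (hmono r) hJr.
  exists P; first by rewrite mem_cat hP.
  by apply: subset_trans hJP; exact: sub_adjoin.
have [hJs|hJs] := pselect (adjoin R J s = R); last first.
  have [P hP hJP] := hQsJ _ (adjoin_ideal hR hJ hs) (hmono s) hJs.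
  exists P; first by rewrite mem_cat hP orbT.
  by apply: subset_trans hJP; exact: sub_adjoin.
exfalso; apply: JR; apply: (ideal_mem1 hJ).
have [i [a [hi ha e1]]] : adjoin R J r 1 by rewrite hJr; exact: subring1.
have [j [b [hj hb e2]]] : adjoin R J s 1 by rewrite hJs; exact: subring1.
have -> : 1 = 1 * i + (r * a) * j + (a * b) * (r * s).
  transitivity ((i + r * a) * (j + s * b)); first by rewrite -e1 -e2 mulr1.
  by rewrite [X in X * i]e2; ring.
apply: (idealD hJ); first apply: (idealD hJ).
- by rewrite mul1r.
- by apply: (idealM hJ) => //; exact: subringM.
- by apply: (idealM hJ); [exact: subringM|exact: hIJ].
Qed.

Lemma prime_avoids_intersection R Q (Ps : seq (set K)) :
  is_dedekind R -> is_prime_ideal R Q ->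
  (forall P, P \in Ps -> is_prime_ideal R P /\ is_nonzero P) -> Q \notin Ps ->
  exists e, [/\ R e, ~ Q e & forall P, P \in Ps -> P e].
Proof.
move=> hR hQ; have hR1 : is_subring R by case: hR.
elim: Ps => [|P Ps ih] hPs.
  exists 1; split => //; first exact: subring1.
  by case: hQ => hQ QR _ h; exact/QR/(ideal_mem1 hQ h).
rewrite inE negb_or => /andP[/eqP QP QPs].
have [] := ih _ QPs => [P' hP'|e [he hQe hPe]].
  by apply: hPs; rewrite inE hP' orbT.
have [hP P0] := hPs P (mem_head _ _).
have [p hp hQp] := nonzero_primes_incomparable hR hP P0 hQ (not_eq_sym QP).
exists (e * p); split => [||P'].
- by apply: subringM => //; exact: (ideal_sub (prime_idealW hP)).
- case: (hQ) => _ _ Qprime /Qprime[] //; exact: (ideal_sub (prime_idealW hP)).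
- rewrite inE => /orP[/eqP ->|hP']; first exact: (idealM (prime_idealW hP)).
  have hPP : is_ideal R P' by apply/prime_idealW/(hPs P' _).1; rewrite inE hP' orbT.
  by apply: (idealMr hPP); [exact: hPe|exact: (ideal_sub (prime_idealW hP))].
Qed.

(** Chinese remainder argument, one prime at a time: when [c] fails at a new
    prime, add to it a multiple, by an element [e] of all the previous primes,
    of an element that does not fail there. *)
Lemma dedekind_generator_at_primes R I (Ps : seq (set K)) :
  is_dedekind R -> is_ideal R I -> is_nonzero I ->
  (forall P, P \in Ps -> is_prime_ideal R P /\ is_nonzero P) ->
  exists2 c, I c & forall P, P \in Ps -> exists2 u, colon R I u & ~ P (c * u).
Proof.
move=> hR hI I0; have hR1 : is_subring R by case: hR.
elim: Ps => [|Q Ps ih] hPs; first by have [i hi _] := I0; exists i.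
have hPs' P : P \in Ps -> is_prime_ideal R P /\ is_nonzero P.
  by move=> hP; apply: hPs; rewrite inE hP orbT.
have [c hc hcP] := ih hPs'.
have [hQ Q0] := hPs Q (mem_head _ _).
have [hcQ|hcQ] := pselect (exists2 u, colon R I u & ~ Q (c * u)).
  by exists c => // P; rewrite inE => /orP[/eqP ->|/hcP].
have {}hcQ u : colon R I u -> Q (c * u).
  by move=> hu; apply: contrapT => h; apply: hcQ; exists u.
have QPs : Q \notin Ps.
  by apply/negP => /hcP[u /hcQ].
have [e [he hQe hPe]] := prime_avoids_intersection hR hQ hPs' QPs.
have [a [v [ha hv hQav]]] := dedekind_invertible_at_prime hR hI I0 hQ Q0.
have sub_cancel P x y : is_ideal R P -> P x -> P (x + y) -> P y.
  move=> hP hx hxy; rewrite -[y](addKr x); apply: (idealD hP) => //.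
  rewrite -mulN1r; apply: (idealM hP) => //.
  by apply: subringN => //; exact: subring1.
have Rau u : colon R I u -> R (a * u) by move=> hu; rewrite mulrC; exact: hu.
exists (c + e * a); first by apply: (idealD hI) => //; exact: (idealM hI).
move=> P; rewrite inE => /orP[/eqP ->|hP].
  exists v => //; rewrite mulrDl -mulrA.
  move=> /(sub_cancel _ _ _ (prime_idealW hQ) (hcQ v hv)).
  by case: hQ => _ _ Qprime /Qprime[] //; exact: Rau.
have [u hu hPcu] := hcP P hP; have hPI := prime_idealW (hPs' P hP).1.
have heau : P (e * (a * u)).
  by apply: (idealMr hPI); [exact: hPe|exact: Rau].
by exists u => //; rewrite addrC mulrDl -mulrA => /(sub_cancel _ _ _ hPI heau).
Qed.

(** A nonzero ideal [I] becomes principal, generated by [c], once [1 + x * R] is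
    inverted: [I = (c * u)^-1 * c * (u * I)] and [u * I] is contained in [R].
    Only the finitely many primes containing [x] could contain
    [c * (R : I) + x * R]. *)
Lemma dedekind_generator_mod R I x :
  is_dedekind R -> is_ideal R I -> is_nonzero I -> R x -> x != 0 ->
  exists c u r, [/\ I c, colon R I u, R r & c * u = 1 + x * r].
Proof.
move=> hR hI I0 hx x0; have hR1 : is_subring R by case: hR.
have hxI := multiples_ideal hR1 hx.
have hx1 : multiples R x x by exists 1; rewrite ?mulr1 //; exact: subring1.
have [|Ps [hPs hPsJ]] := dedekind_finitely_many_primes hR hxI.
  by exists x.
have [c hc hcP] := dedekind_generator_at_primes hR hI I0 hPs.
pose cJ := [set y | exists2 u, colon R I u & y = c * u].
have hcJ : is_ideal R cJ.
  split; first split.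
  - exists 0; last by rewrite mulr0.
    by move=> i _; rewrite mul0r; exact: subring0.
  - move=> _ _ [u hu ->] [v hv ->]; exists (u + v); last by rewrite mulrDr.
    by move=> i hi; rewrite mulrDl; apply: subringD; [|exact: hu|exact: hv].
  - move=> r _ hr [u hu ->]; exists (r * u); last by rewrite mulrCA.
    by move=> i hi; rewrite -mulrA; apply: subringM => //; exact: hu.
  - by move=> _ [u hu ->]; rewrite mulrC; exact: hu.
have hB := adjoin_ideal hR1 hcJ hx.
have [eB|nB] := pselect (adjoin R cJ x = R); last first.
  have [] := hPsJ _ hB _ nB.
    by move=> _ [r hr ->]; apply: (idealMr hB) => //; exact: mem_adjoin.
  move=> P hP hBP; have [u hu] := hcP P hP; case.
  by apply/hBP/sub_adjoin => //; exists u.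
have [_ [r [[u hu ->] hr e1]]] : adjoin R cJ x 1.
  by rewrite eB; exact: subring1.
exists c, u, (- r); split => //; first exact: subringN.
by rewrite e1 mulrN addrK.
Qed.

Definition one_plus R x : set K := [set w | exists2 r, R r & w = 1 + x * r].

(** The property of Dedekind domains that passes to directed unions: it
    involves finitely many elements only. *)
Definition pairs_principal_mod R : Prop := forall x a b,
  R x -> R a -> R b -> x != 0 -> a != 0 ->
  exists r s u, [/\ R r, R s, R (a * u), R (b * u) &
                    one_plus R x ((a * r + b * s) * u)].

Lemma dedekind_pairs_principal_mod R : is_dedekind R -> pairs_principal_mod R.
Proof.
move=> hRd x a b hx ha hb x0 a0; have hR : is_subring R by case: hRd.
have hI := adjoin_ideal hR (multiples_ideal hR ha) hb.
have hIa : adjoin R (multiples R a) b a.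
  by apply: sub_adjoin => //; exists 1; rewrite ?mulr1 //; exact: subring1.
have [|c [u [t [[_ [s [[r hr ->] hs ->]]] hu ht e]]]] :=
  dedekind_generator_mod hRd hI _ hx x0; first by exists a.
exists r, s, u; split => //; last by exists t.
- by rewrite mulrC; exact: hu.
- by rewrite mulrC; apply/hu/mem_adjoin/multiples_ideal.
Qed.

(** * Localization and atomic Bezout domains *)

Definition localization D (W : set K) : set K :=
  [set z | exists d w, [/\ D d, W w & z = d / w]].

Definition is_bezout R : Prop := forall a b, R a -> R b -> exists c,
  [/\ multiples R c a, multiples R c b &
      exists r s, [/\ R r, R s & c = a * r + b * s]].

Section Localization.
Variables (D W : set K).
Hypotheses (hD : is_subring D) (W1 : W 1) (WD : W `<=` D) (W0 : ~ W 0)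
  (WM : forall v w, W v -> W w -> W (v * w)).

Lemma denominator_neq0 w : W w -> w != 0.
Proof. by move=> hw; apply/eqP => e; move: hw; rewrite e. Qed.

Lemma localization_overring : is_overring D (localization D W).
Proof.
split.
- apply: subringI.
  + by exists 1, 1; split => //; [exact: subring1|rewrite divr1].
  + move=> _ _ [a [v [ha hv ->]]] [b [w [hb hw ->]]].
    exists (a * w - b * v), (v * w); split; last 1 first.
    * have v0 := denominator_neq0 hv; have w0 := denominator_neq0 hw.
      by field; rewrite ?v0 ?w0.
    * by apply: subringB => //; apply: subringM => //; exact: WD.
    * exact: WM.
  + move=> _ _ [a [v [ha hv ->]]] [b [w [hb hw ->]]].
    exists (a * b), (v * w); split; [exact: subringM|exact: WM|].
    by rewrite mulf_div.
- by move=> d hd; exists d, 1; rewrite divr1.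
- move=> _ [d [w [hd hw ->]]]; exists d, w; split => //; first exact: WD.
  exact: denominator_neq0.
Qed.

Lemma localization_bezout :
  (forall a b, D a -> D b -> a != 0 -> exists r s u,
     [/\ D r, D s, D (a * u), D (b * u) & W ((a * r + b * s) * u)]) ->
  is_bezout (localization D W).
Proof.
have [hS hDS _] := localization_overring.
move=> hpair _ _ [a [v [ha hv ->]]] [b [w [hb hw ->]]].
have v0 := denominator_neq0 hv; have w0 := denominator_neq0 hw.
have [->|a0] := eqVneq a 0.
  exists (b / w); split.
  - by exists 0; [exact: subring0|rewrite mulr0 mul0r].
  - by exists 1; [exact: subring1|rewrite mulr1].
  - exists 0, 1; split; [exact: subring0|exact: subring1|].
    by rewrite mulr0 mulr1 add0r.
have [|||r [s [u [hr hs hau hbu hW]]]] := hpair (a * w) (b * v).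
- by apply: subringM => //; exact: WD.
- by apply: subringM => //; exact: WD.
- by rewrite mulf_neq0.
have := denominator_neq0 hW; rewrite mulf_eq0 negb_or => /andP[c0 u0].
exists ((a * w * r + b * v * s) / (v * w)); split.
- exists ((a * w * u) / ((a * w * r + b * v * s) * u)).
    by exists (a * w * u), ((a * w * r + b * v * s) * u).
  by field; rewrite ?u0 ?c0 ?v0 ?w0.
- exists ((b * v * u) / ((a * w * r + b * v * s) * u)).
    by exists (b * v * u), ((a * w * r + b * v * s) * u).
  by field; rewrite ?u0 ?c0 ?v0 ?w0.
- by exists r, s; split; [exact: hDS|exact: hDS|field; rewrite ?v0 ?w0].
Qed.

End Localization.

(** Induction on the number of irreducible factors. Let [p] be one of them.
    Either all of [I] is divisible by [p], and [I] can be divided by [p], or some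
    [y] in [I] is not, so that [y] and [p] generate the unit ideal and [I]
    contains the product of the remaining factors. *)
Lemma bezout_principal_of_factored R I (s : seq K) :
  is_subring R -> is_bezout R -> (forall a, a \in s -> is_irreducible R a) ->
  is_ideal R I -> I (\prod_(a <- s) a) -> exists2 g, I g & I `<=` multiples R g.
Proof.
move=> hR hB; elim: s I => [|p s ih] I hs hI.
  rewrite big_nil => h1; exists 1 => // x hx.
  by exists x; [exact: (ideal_sub hI)|rewrite mul1r].
have hs' a : a \in s -> is_irreducible R a.
  by move=> ha; apply: hs; rewrite inE ha orbT.
have [hp p0 hpu hpirr] := hs p (mem_head _ _).
rewrite big_cons; set h := \prod_(a <- s) a => hph.
have hh : R h by apply: subring_prod => // a /hs' [].
have [hIp|hIp] := pselect (I `<=` multiples R p).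
  pose J := [set y | R y /\ I (p * y)].
  have hJ : is_ideal R J.
    split; first split.
    - by split; [exact: subring0|rewrite mulr0; exact: ideal0 hI].
    - move=> y z [hy hpy] [hz hpz]; split; first exact: subringD.
      by rewrite mulrDr; exact: (idealD hI).
    - move=> r y hr [hy hpy]; split; first exact: subringM.
      by rewrite mulrCA; exact: (idealM hI).
    - by move=> y [].
  have [|g [hg hpg] hgJ] := ih J hs' hJ; first by split.
  exists (p * g) => // _ /[dup] /hIp[r hr ->] hpr.
  by have [|t ht ->] := hgJ r; [split|exists t; rewrite ?mulrA].
have [y hy hyp] : exists2 y, I y & ~ multiples R p y.
  apply: contrapT => hno; apply: hIp => y hy.
  by apply: contrapT => hyp; apply: hno; exists y.
have [c [[y1 hy1 ey] [p1 hp1 ep] [r [t [hr ht ec]]]]] := hB y p (ideal_sub hI hy) hp.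
have hc : R c.
  by rewrite ec; apply: subringD => //; apply: subringM => //; exact: ideal_sub hy.
case: (hpirr c p1 hc hp1 ep) => -[_ u0 hu].
  apply: (ih I hs' hI); rewrite -/h.
  have -> : h = (c^-1 * (r * h)) * y + (c^-1 * t) * (p * h).
    by rewrite -[LHS](mulKf u0) {2}ec; ring.
  apply: (idealD hI); apply: (idealM hI) => //; apply: subringM => //.
  exact: subringM.
exfalso; apply: hyp; exists (p1^-1 * y1); first exact: subringM.
by rewrite ey ep; field.
Qed.

Lemma bezout_atomic_principal R I :
  is_subring R -> is_bezout R -> is_atomic R -> is_ideal R I -> is_nonzero I ->
  exists2 g, I g & I `<=` multiples R g.
Proof.
move=> hR hB hA hI [x hx x0].
have [[_ _ hxV]|hxu] := pselect (is_unit R x).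
  exists x => // y hy; exists (x^-1 * y); last by rewrite mulVKf.
  by apply: subringM => //; exact: ideal_sub hy.
have [s hs es] := hA x (ideal_sub hI hx) x0 hxu.
by apply: (bezout_principal_of_factored hR hB hs hI); rewrite -es.
Qed.

(** * From atomic overrings to the Dedekind property *)

(** The overring to look at is the localization of [D] at [1 + x * D]: it is a
    Bezout domain, hence, being atomic, a principal ideal domain. *)
Lemma ideal_generator_mod D I x :
  is_subring D -> pairs_principal_mod D ->
  (forall S, is_overring D S -> is_atomic S) ->
  is_ideal D I -> I x -> x != 0 ->
  exists2 g, I g & forall y, I y ->
    exists w d, [/\ one_plus D x w, D d & y * w = g * d].
Proof.
move=> hD hpair hat hI hx x0; have Dx := ideal_sub hI hx.
have W1 : one_plus D x 1 by exists 0; [exact: subring0|rewrite mulr0 addr0].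
have [W0|W0] := pselect (one_plus D x 0).
  (* Here [x] is a unit, the localization degenerates, and [g = 1] works. *)
  case: W0 => r hr e0; exists 1; last first.
    move=> y hy; exists 1, y; rewrite mulr1 mul1r.
    by split => //; exact: ideal_sub hy.
  have -> : 1 = - r * x by apply/eqP; rewrite -subr_eq0 e0; apply/eqP; ring.
  by apply: (idealM hI) => //; exact: subringN.
have WD : one_plus D x `<=` D.
  by move=> _ [r hr ->]; apply: subringD => //; [exact: subring1|exact: subringM].
have WM v w : one_plus D x v -> one_plus D x w -> one_plus D x (v * w).
  move=> [r hr ->] [s hs ->]; exists (r + s + x * r * s); last by ring.
  by apply: subringD => //; [exact: subringD|do !apply: subringM => //].
pose S := localization D (one_plus D x).
have hS : is_overring D S by exact: localization_overring.
have [hSr hDS _] := hS.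
have hSB : is_bezout S.
  apply: localization_bezout => // a b ha hb a0; exact: hpair.
pose E := localization I (one_plus D x).
have hIE : I `<=` E by move=> i hi; exists i, 1; rewrite divr1.
have hE : is_ideal S E.
  split; first split.
  - exact/hIE/(ideal0 hI).
  - move=> _ _ [i [v [hi hv ->]]] [j [w [hj hw ->]]].
    exists (i * w + j * v), (v * w); split; last 1 first.
    + have v0 := denominator_neq0 W0 hv; have w0 := denominator_neq0 W0 hw.
      by field; rewrite ?v0 ?w0.
    + by apply: (idealD hI); apply: (idealMr hI) => //; exact: WD.
    + exact: WM.
  - move=> _ _ [d [v [hd hv ->]]] [i [w [hi hw ->]]].
    exists (d * i), (v * w); split; [exact: (idealM hI)|exact: WM|].
    by rewrite mulf_div.
  - by move=> _ [i [w [hi hw ->]]]; exists i, w; split => //; exact: ideal_sub hi.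
have [|_ [g [v [hg hv ->]]] hgE] := bezout_atomic_principal hSr hSB (hat _ hS) hE.
  by exists x => //; exact: hIE.
exists g => // y /hIE/hgE[_ [d [w [hd hw ->]]] ->].
exists (v * w), d; split => //; first exact: WM.
by field; rewrite ?(denominator_neq0 W0 hv) ?(denominator_neq0 W0 hw).
Qed.

Section AtomicOverrings.
Variable D : set K.
Hypotheses (hD : is_subring D) (hpair : pairs_principal_mod D)
  (hat : forall S, is_overring D S -> is_atomic S).

(** An ideal [I] containing [x] is generated by [x] and the [g] of
    [ideal_generator_mod]: [y * (1 + x * e) = g * d] gives
    [y = g * d - (e * y) * x]. *)
Lemma atomic_overrings_noetherian : is_noetherian D.
Proof.
move=> I hI; have [[x hx x0]|I0] := pselect (is_nonzero I); last first.
  exists 0%N, (fun=> 0); apply/seteqP; split => [y hy|_ [c _ ->]].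
    exists (fun=> 0) => [i|]; first exact: subring0.
    rewrite big_ord0; apply: contrapT => /eqP y0.
    by apply: I0; exists y.
  by rewrite big_ord0; exact: (ideal0 hI).
have [g hg hgI] := ideal_generator_mod hD hpair hat hI hx x0.
pose e (i : 'I_2) := if i == ord0 then g else x.
exists 2%N, e; apply/seteqP; split; last first.
  by apply: span_sub; [case: hI|move=> i; rewrite /e; case: ifP].
move=> y hy; have [_ [d [[r hr ->] hd eyd]]] := hgI y hy.
exists (fun i => if i == ord0 then d else - (r * y)) => [i|].
  case: ifP => // _; apply: subringN => //.
  by apply: subringM => //; exact: ideal_sub hy.
rewrite big_ord_recl big_ord1 /e /= [d * g]mulrC -eyd; ring.
Qed.

(** For a prime [P] containing [x] and [g, h] the elements of
    [ideal_generator_mod] for [P] and for an ideal [I] containing [P], one has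
    [g * w = h * d]. If [h] is in [P] then [I] is contained in [P]; otherwise
    [d] is in [P], hence a multiple of [g] up to [1 + x * D], and
    cancelling [g] puts an element of [1 + x * D] in [I]. *)
Lemma atomic_overrings_primes_maximal P :
  is_prime_ideal D P -> is_nonzero P -> is_maximal_ideal D P.
Proof.
move=> [hP PD Pprime] [x hx x0]; split => // I hI hPI.
have [g hg hgP] := ideal_generator_mod hD hpair hat hP hx x0.
have [h hh hhI] := ideal_generator_mod hD hpair hat hI (hPI x hx) x0.
have one_plus_mem J w : is_ideal D J -> J x -> one_plus D x w -> J w -> J 1.
  move=> hJ hJx [r hr ->] h1; have -> : 1 = (1 + x * r) + (- r) * x by ring.
  by apply: (idealD hJ) => //; apply: (idealM hJ) => //; exact: subringN.
have notP w : one_plus D x w -> ~ P w.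
  by move=> hw /(one_plus_mem P w hP hx hw) h1; exact/PD/(ideal_mem1 hP h1).
have oneD w : one_plus D x w -> D w.
  move=> [r hr ->]; apply: subringD => //; first exact: subring1.
  by apply: subringM => //; exact: ideal_sub hx.
have g0 : g != 0.
  apply/eqP => g0; have [w [d [hw _]]] := hgP x hx.
  rewrite g0 mul0r => /eqP; rewrite mulf_eq0 (negPf x0) => /eqP w0.
  by apply: (notP w hw); rewrite w0; exact: ideal0 hP.
have [w [d [hw hd egd]]] := hhI g (hPI g hg).
have : P (h * d) by rewrite -egd; apply: (idealMr hP) => //; exact: oneD.
case/Pprime => //; first exact: ideal_sub hh.
  move=> hPh; left; apply/seteqP; split => // y hy.
  have [w' [d' [hw' hd' ey]]] := hhI y hy.
  have : P (y * w') by rewrite ey; exact: (idealMr hP).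
  by case/Pprime => //; [exact: ideal_sub hy|exact: oneD|move/(notP w' hw')].
move=> hPd; right; apply: (ideal_mem1 hI).
have [w' [d' [hw' hd' ed]]] := hgP d hPd.
have eww : w * w' = h * d'.
  by apply: (mulfI g0); rewrite mulrA egd -mulrA ed mulrCA.
have hI1 : I (w * w') by rewrite eww; exact: (idealMr hI).
apply: (one_plus_mem I (w * w')) => //; first exact: hPI.
case: hw hw' => [r hr ->] [s hs ->]; exists (r + s + x * r * s); last by ring.
have Dx := ideal_sub hP hx.
by apply: subringD => //; [exact: subringD|do !apply: subringM => //].
Qed.

End AtomicOverrings.

End Domains.

(** * Directed unions of Dedekind domains *)

Section DirectedUnion.
Context {K : fieldType}.
Variables (T : Type) (R : T -> set K) (D : set K).
Hypotheses (hD : is_subring D) (hR : forall t, is_dedekind (R t))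
  (hdir : forall a b, exists c, R a `<=` R c /\ R b `<=` R c)
  (hunion : forall x, D x <-> exists t, R t x).

Lemma directed_union_finite (s : seq K) :
  (forall a, a \in s -> D a) -> exists t, forall a, a \in s -> R t a.
Proof.
have [t0 _] := (hunion 1).1 (subring1 hD) => hs.
have [|t ht] := finite_family_directed t0 hdir (e := tnth (in_tuple s)).
  by move=> i; apply/hunion/hs/mem_tnth.
by exists t => a /(tnthP (in_tuple s))[i ->].
Qed.

Lemma directed_union_pairs_principal_mod : pairs_principal_mod D.
Proof.
move=> x a b hx ha hb x0 a0.
have [|t ht] := directed_union_finite (s := [:: x; a; b]).
  by move=> y; rewrite !inE => /or3P[] /eqP ->.
have RD y : R t y -> D y by move=> hy; apply/hunion; exists t.
have [| | |r [s [u [hr hs hau hbu [q hq e]]]]] :=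
  dedekind_pairs_principal_mod (hR t) (x := x) (a := a) (b := b) _ _ _ x0 a0.
- by apply: ht; rewrite !inE eqxx.
- by apply: ht; rewrite !inE eqxx orbT.
- by apply: ht; rewrite !inE eqxx !orbT.
exists r, s, u; split; [exact: RD..|].
by exists q => //; exact: RD.
Qed.

Lemma directed_union_integrally_closed : is_integrally_closed D.
Proof.
move=> x [a [b [ha hb b0 ex]]] [p [pmon /allP pD px]].
have [|t ht] := directed_union_finite (s := a :: b :: p).
  by move=> y; rewrite !inE => /or3P[/eqP ->|/eqP ->|/pD/set_mem].
apply/hunion; exists t; have [_ _ hIC _] := hR t; apply: hIC.
  by exists a, b; split => //; apply: ht; rewrite !inE eqxx ?orbT.
exists p; split => //; apply/allP => y hy; apply/mem_set/ht.
by rewrite !inE hy !orbT.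
Qed.

End DirectedUnion.

Theorem theorem3p6 (K : fieldType) (D : set K)
    (disp : Order.disp_t) (L : porderType disp) (R : L -> set K)
    (hD : is_prufer D)
    (hR : is_directed_integral_system R)
    (hRDedekind : forall l : L, is_dedekind (R l))
    (hunion : D = \bigcup_(l in [set: L]) R l) :
  (forall S : set K, is_overring D S -> is_atomic S) <-> is_dedekind D.
Proof.
split=> [hat|[_ hN _ _] S hS]; last first.
  apply: noetherian_atomic; first by case: hS.
  exact: prufer_noetherian_overring hS.
have hDr : is_subring D by case: hD.
have [[hdir _ hmono] _] := hR.
have hdir' a b : exists c, R a `<=` R c /\ R b `<=` R c.
  by have [c /andP[hac hbc]] := hdir a b; exists c; split; exact: hmono.
have hD' x : D x <-> exists l, R l x.
  by rewrite hunion; split => [[l _ hx]|[l hx]]; exists l.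
have hpair := directed_union_pairs_principal_mod hDr hRDedekind hdir' hD'.
split => //.
- exact: atomic_overrings_noetherian.
- exact: directed_union_integrally_closed hDr hRDedekind hdir' hD'.
- by move=> P; exact: atomic_overrings_primes_maximal.
Qed.
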